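(* Consider the stochastic wave equation on the sphere $\partial_{tt}u(t)-\Delta_{\mathbb S^2}u(t)=\dot L(t)$ with initial values $(u(0),\partial_t u(0))=(v_1,v_2)\in[L^2(\mathbb S^2,\mathbb R)]^2$. Assume that the expected initial energy satisfies $\mathbb E[\mathcal E(0)]<\infty$ and that the mean-zero $Q$-Lévy process $L$ is trace-class. Furthermore, assume $0<\mathbb E[\mathcal E_0^\kappa-\mathcal E_0^{0,0}]$. Let $(u_{1,n}^\kappa,u_{2,n}^\kappa)$ be the fully discrete approximation given by the forward Euler--Maruyama scheme with time step $\tau>0$. Then its energy grows exponentially fast in time: $$\mathbb E[\mathcal E_n^\kappa]\ge\exp\left(\tfrac12\tau t_n\right)\mathbb E\left[\mathcal E_0^\kappa-\mathcal E_0^{0,0}\right]$$ for every discrete time $t_n=n\tau$ with integer $n\ge0$.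
   Context: $\mathbb S^2\subset\mathbb R^3$ is the unit sphere with its surface measure, $L^2(\mathbb S^2)=L^2(\mathbb S^2,\mathbb R)$ with inner product $\langle\cdot,\cdot\rangle$ and norm $\|\cdot\|$, and $\Delta_{\mathbb S^2}$ is the Laplace--Beltrami operator. The real spherical harmonics $(Y_{\ell,m})_{\ell\ge0,\,-\ell\le m\le\ell}$ form an orthonormal basis of $L^2(\mathbb S^2)$ with $-\Delta_{\mathbb S^2}Y_{\ell,m}=\lambda_\ell Y_{\ell,m}$, $\lambda_\ell=\ell(\ell+1)$. The initial energy is $\mathcal E(0)=\frac12\left(\|v_2\|^2+\|(-\Delta_{\mathbb S^2})^{1/2}v_1\|^2\right)$. $(\Omega,\mathcal F,(\mathcal F_t)_{t\ge0},\mathbb P)$ is a complete filtered probability space; $v_1,v_2$ are $\mathcal F_0$-measurable (possibly random). $L$ is a square-integrable $L^2(\mathbb S^2)$-valued Lévy process with respect to $(\mathcal F_t)$ (adapted, $L(0)=0$, stochastically continuous, stationary increments, $L(t)-L(s)$ independent of $\mathcal F_s$ for $s\le t$), with $\mathbb E[L(t)]=0$ and covariance operator $Q$ (symmetric, positive semi-definite): $\mathbb E[\langle L(t),f\rangle\langle L(t),g\rangle]=t\langle Qf,g\rangle$. ''Trace-class'' means $\operatorname{Tr}(Q)=\sum_{\ell,m}\langle QY_{\ell,m},Y_{\ell,m}\rangle<\infty$. For an integer $\kappa>0$, $\mathcal P_\kappa$ is the orthogonal projection of $L^2(\mathbb S^2)$ onto $H^\kappa=\operatorname{span}\{Y_{\ell,m}:0\le\ell\le\kappa,\,-\ell\le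 m\le\ell\}$ and $\Delta^\kappa_{\mathbb S^2}$ is the restriction of $\Delta_{\mathbb S^2}$ to $H^\kappa$. With $t_n=n\tau$ and $\Delta L_n=L(t_{n+1})-L(t_n)$, the forward Euler--Maruyama scheme is $$u_{1,n+1}^\kappa=u_{1,n}^\kappa+\tau u_{2,n}^\kappa,\qquad u_{2,n+1}^\kappa=u_{2,n}^\kappa+\tau\Delta^\kappa_{\mathbb S^2}u_{1,n}^\kappa+\mathcal P_\kappa\Delta L_n,$$ started at $(u_{1,0}^\kappa,u_{2,0}^\kappa)=(\mathcal P_\kappa v_1,\mathcal P_\kappa v_2)$. Its energy is $\mathcal E_n^\kappa=\frac12\left(\|u_{2,n}^\kappa\|^2+\|(-\Delta^\kappa_{\mathbb S^2})^{1/2}u_{1,n}^\kappa\|^2\right)=\sum_{\ell=0}^\kappa\sum_{m=-\ell}^\ell\mathcal E_n^{\ell,m}$, where $u_{i,n}^{\ell,m}=\langle u_{i,n}^\kappa,Y_{\ell,m}\rangle$ and $\mathcal E_n^{\ell,m}=\frac12\left(|u_{2,n}^{\ell,m}|^2+\lambda_\ell|u_{1,n}^{\ell,m}|^2\right)$.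
   Formalization: The time step is restricted to 0 < τ ≤ 2; for all τ > 0 the claim is false (L = 0, v_1 = 0, v_2 = Y_{1,0}, κ = 1, τ = 3, n = 1 gives energy 9.5 < e^{4.5}/2), and for general data it holds exactly up to τ ≈ 2.16. *)

(* Defs.v *)
From HB Require Import structures.
From mathcomp Require Import all_boot all_order all_algebra.
From mathcomp Require Import all_classical all_reals all_analysis.
From mathcomp Require Import measurable_realfun.

Set Implicit Arguments.
Unset Strict Implicit.
Unset Printing Implicit Defensive.
Import Order.TTheory GRing.Theory Num.Theory.
Import numFieldNormedType.Exports.

Local Open Scope classical_set_scope.
Local Open Scope ring_scope.

Section sphere.
Context {R : realType}.

(* R^3 is the product R * R * R. Its library norm is the sup norm, which only
   serves for the topology (derivatives); the sphere uses the Euclidean norm. *)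
Definition enorm (x : R * R * R) : R :=
  Num.sqrt (x.1.1 ^+ 2 + x.1.2 ^+ 2 + x.2 ^+ 2).

Definition unit_sphere : set (R * R * R) := [set x | enorm x = 1].

Definition radial_proj (x : R * R * R) : R * R * R := (enorm x)^-1 *: x.

Definition basis_vec (i : 'I_3) : R * R * R :=
  (((i == 0 :> nat)%:R, (i == 1 :> nat)%:R), (i == 2 :> nat)%:R).

(* Laplace--Beltrami operator of the round sphere: the Euclidean Laplacian of
   the extension of f that is constant along rays, evaluated on the sphere. *)
Definition laplace_beltrami (f : R * R * R -> R) (x : R * R * R) : R :=
  \sum_(i < 3) 'D_(basis_vec i) ('D_(basis_vec i) (f \o radial_proj)) x.

Definition twice_differentiable_on_sphere (f : R * R * R -> R) : Prop :=
  forall x : R * R * R, x != 0 ->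
    differentiable (f \o radial_proj) x /\
    forall i : 'I_3, differentiable ('D_(basis_vec i) (f \o radial_proj)) x.

Definition spherical_coord (t : R * R) : R * R * R :=
  ((sin t.1 * cos t.2, sin t.1 * sin t.2), cos t.1).

Definition angles : set (R * R) := `[0, pi] `*` `[0, 2 * pi].

(* sin(theta) dtheta dphi, seen as a measure on R^3 carried by the sphere *)
Definition surface_measure (A : set (R * R * R)) : \bar R :=
  (\int[lebesgue_measure \x lebesgue_measure]_(t in
      angles `&` spherical_coord @^-1` A) (sin t.1)%:E)%E.

Lemma measurable_spherical_coord : measurable_fun setT spherical_coord.
Proof.
have ms (f : R * R -> R) : measurable_fun setT f ->
    measurable_fun setT (fun t => sin (f t)).
  by move=> mf; apply: measurableT_comp => //;
     apply: continuous_measurable_fun; exact: continuous_sin.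
have mc (f : R * R -> R) : measurable_fun setT f ->
    measurable_fun setT (fun t => cos (f t)).
  by move=> mf; apply: measurableT_comp => //;
     apply: continuous_measurable_fun; exact: continuous_cos.
apply: measurable_fun_pair; last exact: mc.
by apply: measurable_fun_pair; apply: measurable_funM; (exact: ms || exact: mc).
Qed.

Lemma measurable_angles : measurable angles.
Proof. exact: measurableX. Qed.

Lemma measurable_angles_preimage (A : set (R * R * R)) : measurable A ->
  measurable (angles `&` spherical_coord @^-1` A).
Proof.
move=> mA; apply: measurableI; first exact: measurable_angles.
by rewrite -[X in measurable X]setTI; exact: measurable_spherical_coord.
Qed.

Let surface_measure0 : surface_measure set0 = 0%E.
Proof. by rewrite /surface_measure preimage_set0 setI0 integral_set0. Qed.

Let surface_measure_ge0 A : (0 <= surface_measure A)%E.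
Proof.
apply: integral_ge0 => t [[/= + _] _]; rewrite in_itv/= => t0.
by rewrite lee_fin sin_ge0_pi// in_itv.
Qed.

Let surface_measure_sigma_additive : semi_sigma_additive surface_measure.
Proof.
move=> F mF tF mUF; rewrite /surface_measure preimage_bigcup setI_bigcupr.
rewrite ge0_integral_bigcup//=.
- apply: is_cvg_ereal_nneg_natsum_cond => n _ _.
  exact: surface_measure_ge0.
- by move=> n; exact: measurable_angles_preimage.
- rewrite -setI_bigcupr -preimage_bigcup; apply: measurable_funTS.
  apply/measurable_EFinP; apply: measurableT_comp => //.
  by apply: continuous_measurable_fun; exact: continuous_sin.
- move=> t [n _ [[/= + _] _]]; rewrite in_itv/= => t0.
  by rewrite lee_fin sin_ge0_pi// in_itv.
- apply/trivIsetP => /= i j _ _ ij; rewrite setIACA -preimage_setI.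
  by move/trivIsetP : tF => /(_ _ _ Logic.I Logic.I ij) ->; rewrite preimage_set0 setI0.
Qed.

HB.instance Definition _ := isMeasure.Build _ _ _ surface_measure
  surface_measure0 surface_measure_ge0 surface_measure_sigma_additive.

End sphere.


(* Elements of L^2(S^2) are represented by square-integrable functions; a random
   element of the quotient by a.e. equality lifts to this type by choosing
   representatives, and every notion below is invariant under a.e. equality. *)
Notation L2S R := (LfunType (@surface_measure R) (lee1n 2)).

Section hilbert.
Context {R : realType}.
Implicit Types (f g : R * R * R -> R).

Definition inner f g : R :=
  \int[surface_measure]_(x in unit_sphere) (f x * g x).

Definition L2norm f : R := Num.sqrt (inner f f).

Definition L2_open (U : set (L2S R)) : Prop :=
  forall x, U x -> exists2 r : R, 0 < r &
    forall y : L2S R, L2norm (y - x) < r -> U y.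

Definition L2_borel : set (set (L2S R)) := <<s [set U | L2_open U] >>.

(* orders l = [:: - l; ...; l] *)
Definition orders (l : nat) : seq int :=
  [seq i%:Z - l%:Z | i <- iota 0 (2 * l)%N.+1].

Definition eigval (l : nat) : R := (l * l.+1)%N%:R.

(* Y is a system of real spherical harmonics: an orthonormal basis of L^2(S^2)
   of eigenfunctions. It is not unique (any orthogonal change of basis inside a
   degree gives another one), so statements quantify over all such systems.
   Y l m is constrained only for m \in orders l. *)
Record real_spherical_harmonics (Y : nat -> int -> L2S R) : Prop := {
  harmonics_differentiable : forall l m, m \in orders l ->
    twice_differentiable_on_sphere (Y l m) ;
  harmonics_eigen : forall l m x, m \in orders l -> unit_sphere x ->
    - laplace_beltrami (Y l m) x = eigval l * Y l m x ;
  harmonics_orthonormal : forall l m l' m',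
    m \in orders l -> m' \in orders l' ->
    inner (Y l m) (Y l' m') = ((l == l') && (m == m'))%:R ;
  harmonics_complete : forall f : L2S R,
    (forall l m, m \in orders l -> inner f (Y l m) = 0) -> L2norm f = 0 }.

Record covariance_operator (Q : L2S R -> L2S R) : Prop := {
  covariance_linear : forall (a : R) (f g : L2S R),
    L2norm (Q (a *: f + g) - (a *: Q f + Q g)) = 0 ;
  covariance_symmetric : forall f g : L2S R, inner (Q f) g = inner f (Q g) ;
  covariance_psd : forall f : L2S R, 0 <= inner (Q f) f }.

Variable Y : nat -> int -> L2S R.

Definition trace (Q : L2S R -> L2S R) : \bar R :=
  (\sum_(0 <= l <oo) (\sum_(m <- orders l) inner (Q (Y l m)) (Y l m))%:E)%E.

(* 1/2 (||v2||^2 + ||(-Delta)^(1/2) v1||^2), where (-Delta)^(1/2) is given by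
   the spectral calculus; the value is +oo when v1 is not in its domain. *)
Definition initial_energy (v1 v2 : L2S R) : \bar R :=
  ((2^-1)%:E * ((L2norm v2 ^+ 2)%:E + \sum_(0 <= l <oo)
    (\sum_(m <- orders l) eigval l * inner v1 (Y l m) ^+ 2)%:E))%E.

Variable kappa : nat.

Definition proj f : R * R * R -> R := fun x =>
  \sum_(l < kappa.+1) \sum_(m <- orders l) inner f (Y l m) * Y l m x.

(* (-Delta^kappa)^(1/2) on H^kappa *)
Definition sqrt_neg_laplace f : R * R * R -> R := fun x =>
  \sum_(l < kappa.+1) \sum_(m <- orders l)
    Num.sqrt (eigval l) * inner f (Y l m) * Y l m x.

(* One path of the scheme; dL n is the n-th noise increment. The iterates lie
   in H^kappa, where Delta^kappa is laplace_beltrami. *)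
Fixpoint euler_maruyama (tau : R) (v1 v2 : L2S R) (dL : nat -> L2S R) (n : nat)
    : (R * R * R -> R) * (R * R * R -> R) :=
  if n is k.+1 then
    let u := euler_maruyama tau v1 v2 dL k in
    (fun x => u.1 x + tau * u.2 x,
     fun x => u.2 x + tau * laplace_beltrami u.1 x + proj (dL k) x)
  else (proj v1, proj v2).

Definition energy (u : (R * R * R -> R) * (R * R * R -> R)) : R :=
  2^-1 * (L2norm u.2 ^+ 2 + L2norm (sqrt_neg_laplace u.1) ^+ 2).

Definition mode_energy (l : nat) (m : int)
    (u : (R * R * R -> R) * (R * R * R -> R)) : R :=
  2^-1 * (`|inner u.2 (Y l m)| ^+ 2 + eigval l * `|inner u.1 (Y l m)| ^+ 2).

End hilbert.

Section levy.
Context d (Omega : measurableType d) (R : realType) (P : probability Omega R).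

(* Only the times t >= 0 are relevant. As F 0 consists of measurable sets, the
   last field says in particular that P is complete. *)
Record complete_filtration (F : R -> set (set Omega)) : Prop := {
  filtration_sigma_algebra : forall t : R, 0 <= t -> sigma_algebra setT (F t) ;
  filtration_sub : forall t : R, 0 <= t -> F t `<=` measurable ;
  filtration_mono : forall s t : R, 0 <= s -> s <= t -> F s `<=` F t ;
  filtration_complete : P.-negligible `<=` F 0 }.

Definition L2_measurable (G : set (set Omega)) (X : Omega -> L2S R) : Prop :=
  forall B, L2_borel B -> G (X @^-1` B).

Definition L2_independent (G : set (set Omega)) (X : Omega -> L2S R) : Prop :=
  forall A B, G A -> L2_borel B -> P (A `&` X @^-1` B) = (P A * P (X @^-1` B))%E.

Record square_integrable_levy (F : R -> set (set Omega))
    (L : R -> Omega -> L2S R) : Prop := {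
  levy_adapted : forall t : R, 0 <= t -> L2_measurable (F t) (L t) ;
  levy_start : {ae P, forall w, L2norm (L 0 w) = 0} ;
  levy_stochastic_continuity : forall t e : R, 0 <= t -> 0 < e ->
    P [set w | e <= L2norm (L s w - L t w)]
      @[s --> within [set s | 0 <= s] (nbhs t)] --> 0%E ;
  levy_stationary : forall (s t : R) B, 0 <= s -> s <= t -> L2_borel B ->
    P [set w | B (L t w - L s w)] = P [set w | B (L (t - s) w)] ;
  levy_independent : forall s t : R, 0 <= s -> s <= t ->
    L2_independent (F s) (fun w => L t w - L s w) ;
  levy_square_integrable : forall t : R, 0 <= t ->
    ('E_P[(fun w => L2norm (L t w) ^+ 2)%R] < +oo)%E }.

(* E[L(t)] = 0, in the weak (Pettis) sense *)
Definition mean_zero (L : R -> Omega -> L2S R) : Prop :=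
  forall (t : R) (f : L2S R), 0 <= t -> ('E_P[fun w => inner (L t w) f] = 0)%E.

Definition has_covariance (L : R -> Omega -> L2S R) (Q : L2S R -> L2S R) : Prop :=
  forall (t : R) (f g : L2S R), 0 <= t ->
    ('E_P[(fun w => inner (L t w) f * inner (L t w) g)%R] =
      (t * inner (Q f) g)%:E)%E.

End levy.

(* Main.v *)
Require Import Defs.
From mathcomp Require Import all_boot all_order all_algebra.
From mathcomp Require Import all_classical all_reals all_analysis.
From mathcomp Require Import measurable_realfun ring lra.
Import Order.TTheory GRing.Theory Num.Theory.
Import numFieldNormedType.Exports.
Local Open Scope classical_set_scope.
Local Open Scope ring_scope.

(** The forward Euler scheme amplifies every oscillating mode. In the basis of
    spherical harmonics the scheme decouples ([euler_maruyama_modes]): the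
    coefficients (a, b) of position and velocity in a mode with eigenvalue lam
    follow

      a' = a + tau b,   b' = b - tau lam a + xi,

    where xi is the coefficient of the noise increment, and the energy of the
    iterate is the sum of the mode energies (b^2 + lam a^2) / 2
    ([energy_modes]). A direct computation shows that one step multiplies the
    energy of the mode by 1 + tau^2 lam and adds the terms
    (b - tau lam a) xi and xi^2 / 2. The first of these has mean zero, because xi
    is centred and independent of the past ([independent_expectationM]), and the
    second is nonnegative; so the expected mode energy grows at least by the
    factor 1 + tau^2 lam ([oscillator_energy_step]).

    In degree at least 1 one has lam >= 2, and 1 + 2 x >= exp (x / 2) holds for
    0 <= x <= 4 ([expR_half_le]); with x = tau^2, where tau <= 2 keeps x in this
    range, n steps give the factor exp (n tau^2 / 2) = exp (tau t_n / 2)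
    ([oscillator_energy_growth]). Summing over the modes of degree at least 1
    yields the bound: the degree 0 mode is removed from the initial energy on
    the smaller side and contributes a nonnegative amount on the larger side.

    What remains is integrability. The coefficients of degree at least 1 stay
    square-integrable: initially because lam > 0 lets the expected initial
    energy control both of them, and at each step because the covariance of the
    noise is finite. *)

(** * The inner product of L^2 of the sphere *)

Section inner_product.
Context {R : realType}.
Implicit Types f g h : L2S R.

Lemma measurable_unit_sphere : measurable (@unit_sphere R).
Proof.
rewrite (_ : unit_sphere = setT `&` enorm @^-1` [set 1]); last by rewrite setTI.
suff: measurable_fun setT (@enorm R) by apply.
apply: measurableT_comp; last first.
  by repeat (apply: measurable_funD || apply: measurable_funX
    || apply: measurableT_comp).
apply: continuous_measurable_fun; exact: sqrt_continuous.
Qed.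

Lemma integrable_inner f g :
  surface_measure.-integrable unit_sphere (EFin \o (fun x => f x * g x)).
Proof.
apply: (@integrableS _ _ _ _ setT) => //; first exact: measurable_unit_sphere.
by apply/Lfun1_integrable; apply: Lfun2_mul_Lfun1; exact: LfunP.
Qed.

(** The iterates of the scheme are combinations of harmonics on the sphere only,
    and inner products see nothing else. *)
Lemma eq_inner (u v u' v' : R * R * R -> R) :
  (forall x, unit_sphere x -> u x = u' x) ->
  (forall x, unit_sphere x -> v x = v' x) -> inner u v = inner u' v'.
Proof.
by move=> uu' vv'; apply: eq_Rintegral => x /[!inE] xS; rewrite uu'// vv'.
Qed.

Lemma innerC (u v : R * R * R -> R) : inner u v = inner v u.
Proof. by apply: eq_Rintegral => x _; rewrite mulrC. Qed.

Lemma innerDl f g h : inner (f + g) h = inner f h + inner g h.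
Proof.
rewrite /inner -RintegralD; [|exact: measurable_unit_sphere|exact: integrable_inner..].
by apply: eq_Rintegral => x _; rewrite /= mulrDl.
Qed.

Lemma innerZl (a : R) f h : inner (a *: f) h = a * inner f h.
Proof.
rewrite /inner -RintegralZl; [|exact: measurable_unit_sphere|exact: integrable_inner].
by apply: eq_Rintegral => x _; rewrite /= mulrA.
Qed.

Lemma innerBl f g h : inner (f - g) h = inner f h - inner g h.
Proof. by rewrite innerDl -scaleN1r innerZl mulN1r. Qed.

Lemma lincombE (J : Type) (s : seq J) (c : J -> R) (y : J -> L2S R) :
  (fun x => \sum_(p <- s) c p * y p x) = \sum_(p <- s) c p *: y p.
Proof.
apply/funext => x; elim: s => [|p s IH]; first by rewrite !big_nil.
by rewrite !big_cons IH.
Qed.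

Lemma inner_suml (J : Type) (s : seq J) (c : J -> R) (y : J -> L2S R) h :
  inner (fun x => \sum_(p <- s) c p * y p x) h
  = \sum_(p <- s) c p * inner (y p) h.
Proof.
rewrite lincombE; elim: s => [|p s IH]; last by rewrite !big_cons innerDl IH innerZl.
by rewrite !big_nil -(scale0r 0) innerZl mul0r.
Qed.

Lemma inner_ge0 (u : R * R * R -> R) : 0 <= inner u u.
Proof. by apply: Rintegral_ge0 => x _; rewrite -expr2 sqr_ge0. Qed.

Lemma sqr_L2norm (u : R * R * R -> R) : L2norm u ^+ 2 = inner u u.
Proof. by rewrite sqr_sqrtr// inner_ge0. Qed.

(** The expansion of the square of the norm of f - (f, g) g is nonnegative; this
    is all of the Cauchy--Schwarz inequality that a normalized harmonic needs. *)
Lemma bessel_unit f g : inner g g = 1 -> inner f g ^+ 2 <= L2norm f ^+ 2.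
Proof.
move=> g1; rewrite sqr_L2norm.
have := inner_ge0 (f - inner f g *: g).
rewrite innerBl innerZl ![inner _ (f - _)]innerC !innerBl !innerZl g1.
by rewrite (innerC g f); nra.
Qed.

End inner_product.

(** * Linearity of the Laplace--Beltrami operator *)

Section laplace_beltrami_linear.
Context {R : realType}.
Implicit Types (f g : R * R * R -> R) (x : R * R * R).

Lemma enorm_gt0 x : x != 0 -> 0 < enorm x.
Proof.
move=> x0; rewrite sqrtr_gt0.
have [x1|x1] := eqVneq x.1.1 0; last first.
  have : 0 < x.1.1 ^+ 2 by rewrite exprn_even_gt0.
  have := sqr_ge0 x.1.2; have := sqr_ge0 x.2; lra.
have [x2|x2] := eqVneq x.1.2 0; last first.
  have : 0 < x.1.2 ^+ 2 by rewrite exprn_even_gt0.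
  have := sqr_ge0 x.1.1; have := sqr_ge0 x.2; lra.
have [x3|x3] := eqVneq x.2 0; last first.
  have : 0 < x.2 ^+ 2 by rewrite exprn_even_gt0.
  have := sqr_ge0 x.1.1; have := sqr_ge0 x.1.2; lra.
by case: x x0 x1 x2 x3 => [[a b] c] /= + a0 b0 c0; rewrite a0 b0 c0 eqxx.
Qed.

Lemma unit_sphere_neq0 x : unit_sphere x -> x != 0.
Proof.
move=> xS; apply/negP => /eqP x0; move: xS; rewrite /unit_sphere/= x0 /enorm/=.
by rewrite !expr0n/= !addr0 sqrtr0 => /eqP; rewrite eq_sym oner_eq0.
Qed.

Lemma radial_proj_sphere x : x != 0 -> unit_sphere (radial_proj x).
Proof.
move=> x0; rewrite /unit_sphere/= /radial_proj.
have e0 := enorm_gt0 _ x0; move: (e0); set a := enorm x => a0.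
rewrite /enorm/= /GRing.scale/= !exprMn -!mulrDr sqrtrM ?sqr_ge0//.
rewrite sqrtr_sqr gtr0_norm ?invr_gt0// -[Num.sqrt _]/(enorm x) -/a.
by rewrite mulVf// gt_eqF.
Qed.

(** The radial extension is irregular at the origin; every derivative below is
    taken near a point of the sphere, away from it. *)
Lemma near_neq0 x : x != 0 -> \forall y \near x, y != 0.
Proof.
move=> x0; apply: open_nbhs_nbhs; split => //.
rewrite (_ : (fun _ => _) = ~` [set 0]); first by rewrite openC;
  exact/accessible_closed_set1/hausdorff_accessible/norm_hausdorff.
by apply/seteqP; split => y /= /eqP.
Qed.

(** The radial extension of f near a point of the sphere only involves values of
    f on the sphere. This lets an iterate be replaced by the combination of
    harmonics with which it agrees there. *)
Lemma eq_laplace_beltrami f g x :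
  (forall y, unit_sphere y -> f y = g y) -> unit_sphere x ->
  laplace_beltrami f x = laplace_beltrami g x.
Proof.
move=> fg /(unit_sphere_neq0 _) x0; apply: eq_bigr => i _.
apply: near_eq_derive; near=> y.
have y0 : y != 0 by near: y; exact: near_neq0.
apply: near_eq_derive; near=> z.
apply/fg/radial_proj_sphere; near: z; exact: near_neq0.
Unshelve. all: by end_near. Qed.

Lemma derive_lincomb (J : eqType) (s : seq J) (c : J -> R)
    (h : J -> R * R * R -> R) (v x : R * R * R) :
  (forall p, p \in s -> derivable (h p) x v) ->
  derivable (fun z => \sum_(p <- s) c p * h p z) x v /\
  'D_v (fun z => \sum_(p <- s) c p * h p z) x = \sum_(p <- s) c p * 'D_v (h p) x.
Proof.
elim: s => [_|p s IH hs].
  rewrite big_nil (_ : (fun _ => _) = cst 0).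
    by split; [exact: derivable_cst|exact: derive_cst].
  by apply/funext => z; rewrite big_nil.
have [dS eS] := IH (fun q qs => hs q (mem_behead (s := p :: s) qs)).
have dp := hs p (mem_head _ _).
rewrite big_cons (_ : (fun _ => _) =
    c p \*: h p + (fun z => \sum_(p <- s) c p * h p z)).
  split; first by apply: derivableD => //; exact: derivableZ.
  by rewrite deriveD ?deriveZ ?eS//; exact: derivableZ.
by apply/funext => z; rewrite big_cons.
Qed.

(** First derivatives of a combination split in a whole neighbourhood of x, which
    is what allows differentiating a second time. *)
Lemma laplace_beltrami_lincomb (J : eqType) (s : seq J) (c : J -> R)
    (y : J -> R * R * R -> R) x :
  (forall p, p \in s -> twice_differentiable_on_sphere (y p)) -> x != 0 ->
  laplace_beltrami (fun z => \sum_(p <- s) c p * y p z) x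
  = \sum_(p <- s) c p * laplace_beltrami (y p) x.
Proof.
move=> ys x0; rewrite /laplace_beltrami.
under [RHS]eq_bigr do rewrite mulr_sumr.
rewrite [RHS]exchange_big/=; apply: eq_bigr => i _; set v := basis_vec i.
have [|_ <-] := @derive_lincomb _ s c (fun p => 'D_v (y p \o radial_proj)) v x.
  by move=> p /ys /(_ x x0)[_ d2]; apply: diff_derivable; exact: d2.
apply: near_eq_derive; near=> z.
have z0 : z != 0 by near: z; exact: near_neq0.
have [|_ <- //] := @derive_lincomb _ s c (fun p => y p \o radial_proj) v z.
by move=> p /ys /(_ z z0)[d1 _]; exact: diff_derivable.
Unshelve. all: by end_near. Qed.

End laplace_beltrami_linear.

(** * The scheme in spherical-harmonic coordinates *)

(** The scheme for the forced oscillator a'' = - lam a + xi, which is what the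
    wave equation becomes in one eigenmode: the pair holds position and
    velocity. *)
Definition mode_euler {R : realType} (tau lam a b : R) (xi : nat -> R) :=
  fix coef (n : nat) : R * R :=
    if n is k.+1 then
      let c := coef k in (c.1 + tau * c.2, c.2 - tau * (lam * c.1) + xi k)
    else (a, b).

Definition oscillator_energy {R : realType} (lam : R) (c : R * R) : R :=
  2^-1 * (c.2 ^+ 2 + lam * c.1 ^+ 2).

(** Keeping the lowest degree l0 as an argument isolates the modes of degree at
    least 1, whose eigenvalues are bounded away from 0. *)
Definition modes (l0 k : nat) : seq (nat * int) :=
  [seq (l, m) | l <- iota l0 k, m <- orders l].

Lemma mem_modes l0 k p : p \in modes l0 k ->
  (l0 <= p.1)%N /\ p.2 \in orders p.1.
Proof.
by move=> /allpairsPdep[l [m []]]; rewrite mem_iota => /andP[? _] ? ->.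
Qed.

Lemma uniq_modes l0 k : uniq (modes l0 k).
Proof.
apply: allpairs_uniq_dep => [|l _|]; first exact: iota_uniq.
  rewrite map_inj_uniq ?iota_uniq// => i j /addIr; by case.
by move=> [l m] [l' m'] _ _ [-> ->].
Qed.

Lemma modesS k : modes 0 k.+1 = (0%N, 0) :: modes 1 k.
Proof. by []. Qed.

Section harmonics.
Context {R : realType} (Y : nat -> int -> L2S R).
Hypothesis hY : real_spherical_harmonics Y.
Variable kappa : nat.

Local Notation M := (modes 0 kappa.+1).
Local Notation Ym p := (Y p.1 p.2).

Lemma sum_modes (V : nmodType) (G : nat -> int -> V) :
  \sum_(l < kappa.+1) \sum_(m <- orders l) G l m = \sum_(p <- M) G p.1 p.2.
Proof.
rewrite big_allpairs_dep.
rewrite -(big_mkord xpredT (fun l => \sum_(m <- orders l) G l m)).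
by rewrite /index_iota subn0.
Qed.

Lemma projE f x : Defs.proj Y kappa f x = \sum_(p <- M) inner f (Ym p) * Ym p x.
Proof. by rewrite /Defs.proj (sum_modes _ (fun l m => inner f (Y l m) * Y l m x)). Qed.

Lemma inner_modes p q : p \in M -> q \in M -> inner (Ym p) (Ym q) = (p == q)%:R.
Proof.
by move=> /mem_modes[_ pM] /mem_modes[_ qM]; rewrite (harmonics_orthonormal hY).
Qed.

Lemma inner_lincomb (c : nat * int -> R) q : q \in M ->
  inner (fun x => \sum_(p <- M) c p * Ym p x) (Ym q) = c q.
Proof.
move=> qM; rewrite (inner_suml _ M c (fun p => Ym p)).
rewrite (bigD1_seq q) ?uniq_modes//= inner_modes// eqxx mulr1.
rewrite big_seq_cond big1 ?addr0// => p /andP[pM pq].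
by rewrite inner_modes// (negPf pq) mulr0.
Qed.

Lemma L2norm_lincomb (c : nat * int -> R) :
  L2norm (fun x => \sum_(p <- M) c p * Ym p x) ^+ 2 = \sum_(p <- M) c p ^+ 2.
Proof.
rewrite sqr_L2norm.
have E := lincombE _ M c (fun p => Ym p).
rewrite (_ : inner _ _ = inner (fun x => \sum_(p <- M) c p * Ym p x)
  (\sum_(p <- M) c p *: Ym p)); last by rewrite -E.
rewrite (inner_suml _ M c (fun p => Ym p)).
rewrite big_seq [RHS]big_seq; apply: eq_bigr => q qM.
by rewrite innerC -E inner_lincomb // expr2.
Qed.

(** The harmonics diagonalize the scheme: on the sphere the iterates are the
    combinations of harmonics whose coefficients run the oscillator scheme
    independently of one another, each driven by its own noise coefficient. *)
Lemma euler_maruyama_modes (tau : R) (v1 v2 : L2S R) (dL : nat -> L2S R) n :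
  let c p := mode_euler tau (eigval p.1) (inner v1 (Ym p)) (inner v2 (Ym p))
               (fun k => inner (dL k) (Ym p)) n in
  let u := euler_maruyama Y kappa tau v1 v2 dL n in
  forall x, unit_sphere x ->
    u.1 x = \sum_(p <- M) (c p).1 * Ym p x /\
    u.2 x = \sum_(p <- M) (c p).2 * Ym p x.
Proof.
elim: n => [|n IH] /= x xS; first by rewrite !projE.
have [IH1 IH2] := IH x xS; rewrite IH1 IH2 projE.
rewrite (eq_laplace_beltrami _ _ _ (fun y yS => (IH y yS).1) xS).
rewrite laplace_beltrami_lincomb ?unit_sphere_neq0//; last first.
  by move=> p /mem_modes[_ pM]; exact: harmonics_differentiable hY _ _ pM.
rewrite !mulr_sumr -!big_split/=; split; first by apply: eq_bigr => p _; ring.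
rewrite big_seq [RHS]big_seq; apply: eq_bigr => p /mem_modes[_ pM].
have := harmonics_eigen hY pM xS => /(canRL opprK) ->; ring.
Qed.

Lemma inner_euler_maruyama (tau : R) (v1 v2 : L2S R) (dL : nat -> L2S R) n p :
  p \in M ->
  let c := mode_euler tau (eigval p.1) (inner v1 (Ym p)) (inner v2 (Ym p))
               (fun k => inner (dL k) (Ym p)) n in
  let u := euler_maruyama Y kappa tau v1 v2 dL n in
  inner u.1 (Ym p) = c.1 /\ inner u.2 (Ym p) = c.2.
Proof.
move=> pM c u; have E := euler_maruyama_modes tau v1 v2 dL n.
split.
  by rewrite (eq_inner _ _ _ _ (fun x xS => (E x xS).1) (fun _ _ => erefl)) inner_lincomb.
by rewrite (eq_inner _ _ _ _ (fun x xS => (E x xS).2) (fun _ _ => erefl)) inner_lincomb.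
Qed.

(** Parseval for the truncated system: the square root of the Laplacian puts the
    weight of each eigenvalue on the position coefficients. *)
Lemma energy_modes (tau : R) (v1 v2 : L2S R) (dL : nat -> L2S R) n :
  energy Y kappa (euler_maruyama Y kappa tau v1 v2 dL n)
  = \sum_(p <- M) oscillator_energy (eigval p.1)
     (mode_euler tau (eigval p.1) (inner v1 (Ym p)) (inner v2 (Ym p))
               (fun k => inner (dL k) (Ym p)) n).
Proof.
have E := euler_maruyama_modes tau v1 v2 dL n.
rewrite /energy sqr_L2norm.
rewrite (eq_inner _ _ _ _ (fun x xS => (E x xS).2) (fun x xS => (E x xS).2)).
rewrite -sqr_L2norm L2norm_lincomb.
have -> : sqrt_neg_laplace Y kappa (euler_maruyama Y kappa tau v1 v2 dL n).1 =
    fun x => \sum_(p <- M) Num.sqrt (eigval p.1) *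
     inner (euler_maruyama Y kappa tau v1 v2 dL n).1 (Ym p) * Ym p x.
  by apply/funext => x; rewrite /sqrt_neg_laplace (sum_modes _ (fun l m =>
    Num.sqrt (eigval l) * inner _ (Y l m) * Y l m x)).
rewrite (L2norm_lincomb (fun p => Num.sqrt (eigval p.1) * inner _ (Ym p))).
rewrite -big_split/= mulr_sumr big_seq [RHS]big_seq; apply: eq_bigr => p pM.
have [-> _] := inner_euler_maruyama tau v1 v2 dL n _ pM.
by rewrite exprMn sqr_sqrtr ?ler0n.
Qed.

Lemma mode_energy00 (tau : R) (v1 v2 : L2S R) (dL : nat -> L2S R) n :
  mode_energy Y 0 0 (euler_maruyama Y kappa tau v1 v2 dL n)
  = oscillator_energy (eigval 0)
     (mode_euler tau (eigval 0) (inner v1 (Y 0%N 0)) (inner v2 (Y 0%N 0))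
               (fun k => inner (dL k) (Y 0%N 0)) n).
Proof.
have M0 : (0%N, 0) \in M by rewrite modesS mem_head.
have [h1 h2] := inner_euler_maruyama tau v1 v2 dL n _ M0.
by rewrite /mode_energy h1 h2 !real_normK ?num_real.
Qed.

End harmonics.

(** * Measurability, independence and orthogonality *)

(** Measurability with respect to a bare set system, so that a sub-sigma-algebra
    of a filtration does not have to be turned into a measurable type. *)
Definition borel_fun {T : Type} {R : realType} (G : set (set T)) (X : T -> R) :=
  forall S : set R, measurable S -> G (X @^-1` S).

Lemma borel_fun_ray (T : Type) (R : realType) (G : set (set T)) (X : T -> R) :
  sigma_algebra setT G -> (forall a, G [set t | a < X t]) -> borel_fun G X.
Proof.
move=> [G0 GC GU] Xray S mS.
have : (@RGenOInfty.G R).-sigma.-measurable S by rewrite -RGenOInfty.measurableE.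
move: S {mS}; apply: (@smallest_sub _ _ _ [set S | G (X @^-1` S)]).
  split => /= [|A GA|A GA]; first by rewrite preimage_set0.
  - by have := GC _ GA; rewrite !setTD preimage_setC.
  - by rewrite preimage_bigcup; exact: GU.
move=> _ [a ->] /=; rewrite (_ : _ @^-1` _ = [set t | a < X t])//.
by apply/seteqP; split => t /=; rewrite in_itv/= andbT.
Qed.

Lemma borel_fun_sub (T : Type) (R : realType) (G H : set (set T)) (X : T -> R) :
  G `<=` H -> borel_fun G X -> borel_fun H X.
Proof. by move=> GH GX S mS; exact/GH/GX. Qed.

Lemma borel_fun_scaleD (T : pointedType) (R : realType) (G : set (set T))
    (a : R) (X Z : T -> R) : sigma_algebra setT G ->
  borel_fun G X -> borel_fun G Z -> borel_fun G (fun t => a * X t + Z t).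
Proof.
move=> sG GX GZ.
have mG (W : T -> R) : borel_fun G W ->
    measurable_fun setT (W : g_sigma_algebraType G -> R).
  move=> GW _ S mS; rewrite setTI.
  by rewrite measurable_g_measurableTypeE//; exact: GW.
have mX := mG _ GX; have mZ := mG _ GZ.
have : measurable_fun setT (fun t : g_sigma_algebraType G => a * X t + Z t).
  by apply: measurable_funD => //; apply: measurable_funM.
move=> m S mS; have := m measurableT S mS.
by rewrite setTI measurable_g_measurableTypeE.
Qed.

(** The coefficient along g is 1-Lipschitz for the L^2 norm by Bessel, so the
    preimages of rays are open. *)
Lemma borel_fun_inner {R : realType} (g : L2S R) : inner g g = 1 ->
  borel_fun L2_borel (fun f : L2S R => inner f g).
Proof.
move=> g1; apply: borel_fun_ray; first exact: smallest_sigma_algebra.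
move=> a; apply: sub_sigma_algebra => f /= af.
exists (inner f g - a); first by rewrite subr_gt0.
move=> h hf; have := bessel_unit (h - f) g g1; rewrite innerBl => b.
have := sqrtr_ge0 (inner (h - f) (h - f)); rewrite -/(L2norm _) => n0.
by nra.
Qed.

Definition random_variable_of {d d'} {T : measurableType d}
    {T' : measurableType d'} (X : T -> T') (mX : measurable_fun setT X) :
    {mfun T >-> T'} :=
  MeasurableFun.Pack (MeasurableFun.Class (isMeasurableFun.Build _ _ _ _ _ mX)).

Section independence.
Context d (T : measurableType d) (R : realType) (P : probability T R).
Local Open Scope ereal_scope.

(** Independence says that the joint law of X and D agrees with the product of
    their laws on rectangles, hence everywhere; by Fubini the integral of the
    product then factors through the mean of D. *)
Lemma independent_expectationM (X D : T -> R) :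
  measurable_fun setT X -> measurable_fun setT D ->
  (forall A B, measurable A -> measurable B ->
    P (X @^-1` A `&` D @^-1` B) = P (X @^-1` A) * P (D @^-1` B)) ->
  X \in Lfun P 2%:E -> D \in Lfun P 2%:E ->
  'E_P[D] = 0 -> 'E_P[(X \* D)%R] = 0.
Proof.
move=> mX0 mD0; pose X' : {RV P >-> R} := random_variable_of X mX0.
pose D' : {RV P >-> R} := random_variable_of D mD0.
rewrite -[X]/(X' : T -> R) -[D]/(D' : T -> R).
move: X' D' => {mX0 mD0 X D} X D XD X2 D2 ED.
have mJ : measurable_fun setT (fun w => (X w, D w)).
  exact: measurable_fun_pair.
pose J : {RV P >-> (R * R)%type} := random_variable_of _ mJ.
pose f (z : (R * R)%type) := (z.1 * z.2)%:E.
have mf : measurable_fun setT f.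
  by apply/measurable_EFinP; exact: measurable_funM.
have iXD : P.-integrable setT (f \o J).
  exact/Lfun1_integrable/Lfun2_mul_Lfun1.
have D1 := Lfun_subset12 (fin_num_measure P _ measurableT) D2.
have JE A : measurable A ->
    (distribution P X \x distribution P D) A = distribution P J A.
  by move=> mA; exact: product_measure_unique.
have JintE (h : (R * R)%type -> \bar R) :
    \int[distribution P X \x distribution P D]_z h z
    = \int[distribution P J]_z h z.
  by apply: eq_measure_integral => A mA _; exact: JE.
have iJ : (distribution P J).-integrable setT f.
  exact: integrable_pushforward.
have iXxD : (distribution P X \x distribution P D).-integrable setT f.
  apply/integrableP; split => //; rewrite JintE; by move/integrableP : iJ => [].
rewrite unlock -[LHS]/(\int[P]_w (f \o J) w) -integral_distribution// -JintE.
rewrite -integral12_prod_meas1//= integral0_eq// => x _.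
rewrite /fubini_F /f/=; under eq_integral do rewrite EFinM.
rewrite integralZl//; last first.
  by apply: integrable_pushforward => //; exact/Lfun1_integrable.
rewrite integral_distribution//; last exact/Lfun1_integrable.
by move: ED; rewrite unlock => ->; rewrite mule0.
Qed.

(** A weight c is allowed so that a bound on a weighted energy can be used as it
    stands. *)
Lemma Lfun2_sqr (c : R) (X : T -> R) : (0 < c)%R -> measurable_fun setT X ->
  \int[P]_w (c * X w ^+ 2)%:E < +oo -> X \in Lfun P 2%:E.
Proof.
move=> c0 mX; under eq_integral do rewrite EFinM.
rewrite ge0_integralZl_EFin//; last 3 first.
- by move=> w _; rewrite lee_fin sqr_ge0.
- by apply/measurable_EFinP; exact: measurable_funX.
- exact: ltW.
move=> cX2; have X2 : \int[P]_w (X w ^+ 2)%:E < +oo.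
  rewrite ltey; apply/eqP => Xoo; move: cX2.
  by rewrite Xoo gt0_muley ?lte_fin// ltxx.
rewrite inE; apply/andP; split; rewrite inE//=.
rewrite /finite_norm unlock poweR_lty//=.
rewrite (eq_integral (fun w => (X w ^+ 2)%:E))// => w _.
by rewrite /= powR_mulrn// real_normK// num_real.
Qed.

(** The integral of a nonnegative function is a supremum over the simple
    functions below it, hence monotone without measurability. This
    covers the initial energy, an infinite series, and the energy of an iterate,
    which contains the mode of degree 0. *)
Lemma ge0_le_lower_integral (f g : T -> \bar R) :
  (forall w, 0 <= f w) -> (forall w, f w <= g w) ->
  \int[P]_w f w <= \int[P]_w g w.
Proof.
move=> f0 fg; have g0 w := le_trans (f0 w) (fg w).
rewrite !ge0_integralTE//; apply: le_ereal_sup => _ [h hf <-].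
by exists h => // w; exact: le_trans (hf w) (fg w).
Qed.

End independence.

(** * Energy growth of one stochastic oscillator *)

Lemma expR2_le9 {R : realType} : expR 2 <= 9 :> R.
Proof.
(* exp (-2) = (exp (-1/8))^16 and exp y >= 1 + y at y = -1/8; cutting 2 into
   16 parts is fine enough, since (8/7)^16 < 9. *)
have h : (7 / 8) ^+ 16 <= expR (- 2) :> R.
  have -> : - 2 = 16%:R * (- 8^-1) :> R by field.
  rewrite expRM_natl; apply: lerXn2r; rewrite ?nnegrE ?expR_ge0//.
  by apply: le_trans (expR_ge1Dx _); lra.
have e0 : 0 < expR 2 :> R := expR_gt0 _.
rewrite expRN in h; have : expR 2 * (7 / 8) ^+ 16 <= 1 :> R.
  by rewrite mulrC -ler_pdivlMr// mul1r.
nra.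
Qed.

(** By convexity it suffices to compare at both ends of the interval from 0 to 4;
    at x = 4 the claim reads exp 2 <= 9. *)
Lemma expR_half_le {R : realType} (x : R) : 0 <= x <= 4 ->
  expR (2^-1 * x) <= 1 + 2 * x.
Proof.
move=> /andP[x0 x4].
have t01 : 0 <= 4^-1 * x <= 1 by apply/andP; split; lra.
have /andP[t0 t1] := t01.
have := convex_expR (Itv01 t0 t1) 2 0.
rewrite !convRE/= expR0 /unstable.onem mulr0 addr0 mulr1.
rewrite (_ : 4^-1 * x * 2 = 2^-1 * x); last by lra.
have := @expR2_le9 R; nra.
Qed.

Section oscillator.
Context d (T : measurableType d) (R : realType) (P : probability T R).
Variables (G : nat -> set (set T)) (xi : nat -> T -> R) (a b : T -> R).
Variables (tau lam : R).
Hypothesis G_sigma : forall n, sigma_algebra setT (G n).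
Hypothesis G_measurable : forall n, G n `<=` measurable.
Hypothesis G_mono : forall n, G n `<=` G n.+1.
Hypothesis aG : borel_fun (G 0) a.
Hypothesis bG : borel_fun (G 0) b.
Hypothesis a2 : a \in Lfun P 2%:E.
Hypothesis b2 : b \in Lfun P 2%:E.
Hypothesis xiG : forall n, borel_fun (G n.+1) (xi n).
Hypothesis xi2 : forall n, xi n \in Lfun P 2%:E.
Hypothesis xi_mean : forall n, ('E_P[xi n] = 0)%E.
Hypothesis xi_indep : forall n A S, G n A -> measurable S ->
  P (A `&` xi n @^-1` S) = (P A * P (xi n @^-1` S))%E.

Let coef n w := mode_euler tau lam (a w) (b w) (xi ^~ w) n.

Lemma coef_adapted n :
  borel_fun (G n) (fun w => (coef n w).1) /\
  borel_fun (G n) (fun w => (coef n w).2).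
Proof.
elim: n => [|n [/(borel_fun_sub _ _ _ _ _ (@G_mono n)) p1
                /(borel_fun_sub _ _ _ _ _ (@G_mono n)) p2]]; first by [].
split.
  rewrite (_ : (fun _ => _) = fun w => tau * (coef n w).2 + (coef n w).1).
    exact: borel_fun_scaleD.
  by apply/funext => w; rewrite addrC.
rewrite (_ : (fun _ => _) =
    fun w => - (tau * lam) * (coef n w).1 + (1 * (coef n w).2 + xi n w)).
  by do 2 (apply: borel_fun_scaleD => //).
by apply/funext => w; rewrite /coef/=; ring.
Qed.

Lemma Lfun2_scaleD (c : R) (X Z : T -> R) : X \in Lfun P 2%:E -> Z \in Lfun P 2%:E ->
  (fun w => c * X w + Z w) \in Lfun P 2%:E.
Proof.
move=> X2 Z2; rewrite (_ : (fun _ => _) = c *: X + Z)//.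
by have [_ ] := @Lfun_submod_closed _ T R P _ (lee1n 2); apply.
Qed.

Lemma coef_Lfun2 n :
  (fun w => (coef n w).1) \in Lfun P 2%:E /\
  (fun w => (coef n w).2) \in Lfun P 2%:E.
Proof.
elim: n => [|n [p1 p2]]; first by [].
split.
  rewrite (_ : (fun _ => _) = fun w => tau * (coef n w).2 + (coef n w).1).
    exact: Lfun2_scaleD.
  by apply/funext => w; rewrite addrC.
rewrite (_ : (fun _ => _) =
    fun w => - (tau * lam) * (coef n w).1 + (1 * (coef n w).2 + xi n w)).
  by do 2 (apply: Lfun2_scaleD => //).
by apply/funext => w; rewrite /coef/=; ring.
Qed.

Lemma Lfun2_sqrE (X : T -> R) : X \in Lfun P 2%:E -> (fun w => X w ^+ 2) \in Lfun P 1.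
Proof.
move=> X2; rewrite (_ : (fun _ => _) = X \* X); first exact: Lfun2_mul_Lfun1.
by apply/funext => w; rewrite /= expr2.
Qed.

Lemma Lfun1_scaleD (c : R) (X Z : T -> R) : X \in Lfun P 1 -> Z \in Lfun P 1 ->
  (fun w => c * X w + Z w) \in Lfun P 1.
Proof.
move=> X2 Z2; rewrite (_ : (fun _ => _) = c *: X + Z)//.
by have [_ ] := @Lfun_submod_closed _ T R P _ (lexx 1%E); apply.
Qed.

Lemma expectation_scaleD (c : R) (X Z : T -> R) : X \in Lfun P 1 -> Z \in Lfun P 1 ->
  'E_P[fun w => (c * X w + Z w)%R]%E = (c%:E * 'E_P[X] + 'E_P[Z])%E.
Proof.
move=> X1 Z1.
have cX : (c \o* X) \in Lfun P 1 by exact: Lfun_scale.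
rewrite -expectationZl// -expectationD//; congr expectation.
by apply/funext => w /=; rewrite mulrC.
Qed.

Lemma oscillator_energy_Lfun1 n :
  (fun w => oscillator_energy lam (coef n w)) \in Lfun P 1.
Proof.
have [p1 p2] := coef_Lfun2 n.
rewrite (_ : (fun _ => _) = fun w =>
   (2^-1 * lam) * (coef n w).1 ^+ 2 + (2^-1 * (coef n w).2 ^+ 2 + cst 0 w)).
  apply: Lfun1_scaleD; first exact: Lfun2_sqrE.
  apply: Lfun1_scaleD; [exact: Lfun2_sqrE|exact: Lfun_cst].
by apply/funext => w; rewrite /oscillator_energy/=; ring.
Qed.

(** Writing (a, b) for position and velocity, the new energy equals exactly
    (1 + tau^2 lam) times the old one, plus (b - tau lam a) xi, plus xi^2 / 2.
    The middle term has mean zero since xi is centred and independent of the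
    past, and the last one is nonnegative. *)
Lemma oscillator_energy_step n :
  ((1 + tau ^+ 2 * lam)%:E * 'E_P[fun w => oscillator_energy lam (coef n w)]
   <= 'E_P[fun w => oscillator_energy lam (coef n.+1 w)])%E.
Proof.
have [p1 p2] := coef_Lfun2 n; have [g1 g2] := coef_adapted n.
pose X w := - (tau * lam) * (coef n w).1 + (coef n w).2.
have X2 : X \in Lfun P 2%:E by exact: Lfun2_scaleD.
have XG : borel_fun (G n) X by exact: borel_fun_scaleD.
have mX : measurable_fun setT X.
  by move=> _ S mS; rewrite setTI; exact/G_measurable/XG.
have mxi : measurable_fun setT (xi n).
  by move=> _ S mS; rewrite setTI; exact/G_measurable/xiG.
have orth : ('E_P[(X \* xi n)%R] = 0)%E.
  apply: (@independent_expectationM _ _ _ _ X (xi n)) => // A S mA mS.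
  by apply: xi_indep => //; exact: XG.
have sqr_xi := Lfun2_sqrE _ (xi2 n).
rewrite (_ : (fun w => oscillator_energy lam (coef n.+1 w)) = fun w =>
    (1 + tau ^+ 2 * lam) * oscillator_energy lam (coef n w)
    + (1 * (X w * xi n w) + 2^-1 * (xi n w) ^+ 2)); last first.
  by apply/funext => w; rewrite /X /oscillator_energy /coef/=; field.
have half_xi : (fun w => 2^-1 * (xi n w) ^+ 2) \in Lfun P 1.
  rewrite (_ : (fun _ => _) = fun w => 2^-1 * (xi n w) ^+ 2 + cst 0 w).
    by apply: Lfun1_scaleD => //; exact: Lfun_cst.
  by apply/funext => w /=; rewrite addr0.
have Xxi : (X \* xi n) \in Lfun P 1 by exact: Lfun2_mul_Lfun1.
rewrite expectation_scaleD ?oscillator_energy_Lfun1//; last exact: Lfun1_scaleD.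
rewrite expectation_scaleD// orth mule0 add0e leeDl//.
by apply: expectation_ge0 => w; rewrite mulr_ge0 ?invr_ge0 ?sqr_ge0.
Qed.

Hypothesis tau_range : 0 < tau <= 2.
Hypothesis lam2 : 2 <= lam.

Lemma oscillator_energy_growth n :
  ((expR (2^-1 * tau * (n%:R * tau)))%:E *
     'E_P[fun w => oscillator_energy lam (coef 0 w)]
   <= 'E_P[fun w => oscillator_energy lam (coef n w)])%E.
Proof.
have e0 k : (0 <= 'E_P[fun w => oscillator_energy lam (coef k w)])%E.
  apply: expectation_ge0 => w; rewrite mulr_ge0 ?invr_ge0// addr_ge0 ?sqr_ge0//.
  by apply: mulr_ge0; [exact: le_trans lam2|exact: sqr_ge0].
elim: n => [|n IH]; first by rewrite mul0r mulr0 expR0 mul1e.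
apply: le_trans (oscillator_energy_step n).
rewrite (_ : 2^-1 * tau * _ = 2^-1 * tau ^+ 2 + 2^-1 * tau * (n%:R * tau)); last first.
  by rewrite -natr1; ring.
rewrite expRD EFinM -muleA; apply: lee_pmul => //.
  by apply: mule_ge0 => //; rewrite lee_fin expR_ge0.
rewrite lee_fin; have /andP[tau0 tau2] := tau_range.
apply: le_trans (expR_half_le (tau ^+ 2) _) _; first by apply/andP; split; nra.
by have := ler_wpM2l (sqr_ge0 tau) lam2; lra.
Qed.

End oscillator.

(** * From one mode to the sphere *)

(** A single mode carries at most the whole energy; this is how the finiteness
    of the expected initial energy makes the initial coefficients of every mode
    with positive eigenvalue square-integrable. *)
Lemma initial_energy_ge_mode {R : realType} (Y : nat -> int -> L2S R)
    (v1 v2 : L2S R) l m :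
  real_spherical_harmonics Y -> m \in orders l ->
  ((oscillator_energy (eigval l) (inner v1 (Y l m), inner v2 (Y l m)))%:E
    <= initial_energy Y v1 v2)%E.
Proof.
move=> hY ml; have Ylm : inner (Y l m) (Y l m) = 1.
  by rewrite (harmonics_orthonormal hY)// !eqxx.
have term_ge0 (k : nat) (j : int) : 0 <= eigval k * inner v1 (Y k j) ^+ 2 :> R.
  by rewrite mulr_ge0 ?sqr_ge0 ?ler0n.
rewrite /oscillator_energy /initial_energy EFinM lee_pmul2l//.
rewrite EFinD; apply: leeD; first by rewrite lee_fin bessel_unit.
apply: le_trans (nneseries_lim_ge l.+1 _); last first.
  by move=> k _ _; rewrite lee_fin sumr_ge0.
rewrite big_nat_recr//= -[leLHS]add0e; apply: leeD.
  by apply: sume_ge0 => k _; rewrite lee_fin sumr_ge0.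
by rewrite lee_fin (big_rem m)//= lerDl sumr_ge0.
Qed.

Lemma expectation_sum_seq {d} {T : measurableType d} {R : realType}
    (P : probability T R) (J : eqType) (s : seq J) (f : J -> T -> R) :
  (forall p, p \in s -> f p \in Lfun P 1) ->
  'E_P[fun w => (\sum_(p <- s) f p w)%R]%E = (\sum_(p <- s) 'E_P[f p])%E.
Proof.
move=> fs; suff [] : (fun w => \sum_(p <- s) f p w) \in Lfun P 1 /\
  'E_P[fun w => (\sum_(p <- s) f p w)%R]%E = (\sum_(p <- s) 'E_P[f p])%E by [].
elim: s fs => [_|p s IH fs].
  rewrite big_nil (_ : (fun _ => _) = cst 0).
    by split; [exact: Lfun_cst|exact: expectation_cst].
  by apply/funext => w; rewrite big_nil.
have [f1 Ef] := IH (fun q qs => fs q (mem_behead (s := p :: s) qs)).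
have fp := fs p (mem_head _ _).
rewrite (_ : (fun _ => _) = fun w => 1 * f p w + \sum_(p <- s) f p w).
  split; first exact: Lfun1_scaleD.
  by rewrite expectation_scaleD// mul1e big_cons Ef.
by apply/funext => w; rewrite big_cons mul1r.
Qed.

(** The coefficient of a noise increment along a unit vector g satisfies the
    assumptions made on the forcing of a single oscillator. *)
Section levy_modes.
Context {d} {Omega : measurableType d} {R : realType} (P : probability Omega R).
Variables (F : R -> set (set Omega)) (L : R -> Omega -> L2S R).
Variable (Q : L2S R -> L2S R).
Hypothesis hF : complete_filtration P F.
Hypothesis hL : square_integrable_levy P F L.
Hypothesis hL0 : mean_zero P L.
Hypothesis hLQ : has_covariance P L Q.
Variable g : L2S R.
Hypothesis g1 : inner g g = 1.

Lemma levy_coef_adapted t : 0 <= t -> borel_fun (F t) (fun w => inner (L t w) g).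
Proof.
by move=> t0 S mS; exact: (levy_adapted hL t0 (borel_fun_inner g g1 _ mS)).
Qed.

Lemma levy_coef_Lfun2 t : 0 <= t -> (fun w => inner (L t w) g) \in Lfun P 2%:E.
Proof.
move=> t0; apply: (Lfun2_sqr _ _ _ P 1) => //.
  move=> _ S mS; rewrite setTI; apply: (filtration_sub hF t0).
  exact: levy_coef_adapted.
rewrite (_ : \int[P]_w _ = 'E_P[(fun w => inner (L t w) g * inner (L t w) g)%R])%E.
  by rewrite hLQ// ltry.
by rewrite unlock; apply: eq_integral => w _; rewrite mul1r expr2.
Qed.

Variables (s t : R).
Hypothesis s0 : 0 <= s.
Hypothesis st : s <= t.

Let t0 : 0 <= t := le_trans s0 st.

Let incrE : (fun w => inner (L t w - L s w) g)
  = fun w => -1 * inner (L s w) g + inner (L t w) g.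
Proof. by apply/funext => w; rewrite innerBl mulN1r addrC. Qed.

Lemma levy_incr_adapted : borel_fun (F t) (fun w => inner (L t w - L s w) g).
Proof.
rewrite incrE; apply: borel_fun_scaleD.
- exact: (filtration_sigma_algebra hF t0).
- apply: (borel_fun_sub _ _ _ _ _ _ (levy_coef_adapted _ s0)).
  exact: (filtration_mono hF s0 st).
- exact: levy_coef_adapted.
Qed.

Lemma levy_incr_Lfun2 : (fun w => inner (L t w - L s w) g) \in Lfun P 2%:E.
Proof. by rewrite incrE; apply: Lfun2_scaleD; exact: levy_coef_Lfun2. Qed.

Lemma levy_incr_mean : ('E_P[(fun w => inner (L t w - L s w) g)%R] = 0)%E.
Proof.
have L1 r : 0 <= r -> (fun w => inner (L r w) g) \in Lfun P 1.
  move=> r0; apply: (Lfun_subset12 (fin_num_measure P _ measurableT)).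
  exact: levy_coef_Lfun2.
by rewrite incrE expectation_scaleD ?L1// !hL0// mule0 adde0.
Qed.

Lemma levy_incr_indep A S : F s A -> measurable S ->
  let xi w := inner (L t w - L s w) g in
  P (A `&` xi @^-1` S) = (P A * P (xi @^-1` S))%E.
Proof.
by move=> FA mS; exact: (levy_independent hL s0 st FA (borel_fun_inner g g1 _ mS)).
Qed.

End levy_modes.

Theorem proposition4 (d : measure_display) (Omega : measurableType d)
  (R : realType) (P : probability Omega R)
  (F : R -> set (set Omega)) (hF : complete_filtration P F)
  (Y : nat -> int -> L2S R) (hY : real_spherical_harmonics Y)
  (L : R -> Omega -> L2S R) (hL : square_integrable_levy P F L)
  (hL0 : mean_zero P L)
  (Q : L2S R -> L2S R) (hQ : covariance_operator Q)
  (hLQ : has_covariance P L Q) (htr : (trace Y Q < +oo)%E)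
  (v1 v2 : Omega -> L2S R)
  (hv1 : L2_measurable (F 0) v1) (hv2 : L2_measurable (F 0) v2)
  (hE : (\int[P]_w initial_energy Y (v1 w) (v2 w) < +oo)%E)
  (kappa : nat) (hkappa : (0 < kappa)%N)
  (tau : R) (htau : 0 < tau) (htau2 : tau <= 2) :
  let t n : R := n%:R * tau in
  let u n w := euler_maruyama Y kappa tau (v1 w) (v2 w)
                 (fun k => L (t k.+1) w - L (t k) w) n in
  let E0 := 'E_P[(fun w => energy Y kappa (u 0%N w) - mode_energy Y 0 0 (u 0%N w))%R]%E in
  (0 < E0)%E ->
  forall n : nat,
    ((expR (2^-1 * tau * t n))%:E * E0
       <= 'E_P[fun w => energy Y kappa (u n w)])%E.
Proof.
move=> t u E0 _ n.
have t0 k : 0 <= t k by rewrite mulr_ge0// ltW.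
have tS k : t k <= t k.+1 by rewrite ler_wpM2r ?ler_nat// ltW.
pose e p k w := oscillator_energy (eigval p.1 : R)
  (mode_euler tau (eigval p.1)
     (inner (v1 w) (Y p.1 p.2)) (inner (v2 w) (Y p.1 p.2))
     (fun j => inner (L (t j.+1) w - L (t j) w) (Y p.1 p.2)) k).
have e_ge0 p k w : 0 <= e p k w.
  by rewrite mulr_ge0 ?invr_ge0// addr_ge0 ?sqr_ge0// mulr_ge0 ?sqr_ge0 ?ler0n.
have energyE k w : energy Y kappa (u k w) =
    e (0%N, 0) k w + \sum_(p <- modes 1 kappa) e p k w.
  by rewrite (energy_modes _ hY) modesS big_cons.
have mode p : p \in modes 1 kappa ->
  (forall k, e p k \in Lfun P 1) /\
  ((expR (2^-1 * tau * t n))%:E * 'E_P[e p 0%N] <= 'E_P[e p n])%E.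
  move=> /mem_modes[p1 p2].
  have Yp : inner (Y p.1 p.2) (Y p.1 p.2) = 1.
    by rewrite (harmonics_orthonormal hY)// !eqxx.
  have lam2 : 2 <= eigval p.1 :> R.
    by rewrite (ler_nat _ 2) -[2%N]/(1 * 2)%N leq_mul.
  have F00 : F (t 0%N) = F 0 by rewrite /t mul0r.
  have coefG (v : Omega -> L2S R) : L2_measurable (F 0) v ->
      borel_fun (F (t 0%N)) (fun w => inner (v w) (Y p.1 p.2)).
    by move=> hv S mS; rewrite F00; exact: (hv _ (borel_fun_inner _ Yp _ mS)).
  have coef2 (v : Omega -> L2S R) (c : R) : L2_measurable (F 0) v -> 0 < c ->
      (forall w, c * inner (v w) (Y p.1 p.2) ^+ 2 <= e p 0%N w) ->
      (fun w => inner (v w) (Y p.1 p.2)) \in Lfun P 2%:E.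
    move=> hv c0 cv; apply: (Lfun2_sqr _ _ _ P c) => //.
      move=> _ S mS; rewrite setTI; apply: (filtration_sub hF (t0 0%N)).
      exact: coefG.
    apply: le_lt_trans hE; apply: ge0_le_lower_integral => w.
      by rewrite lee_fin mulr_ge0 ?sqr_ge0// ltW.
    apply: le_trans (initial_energy_ge_mode _ _ _ _ _ hY p2).
    by rewrite lee_fin; exact: cv.
  have a2 : (fun w => inner (v1 w) (Y p.1 p.2)) \in Lfun P 2%:E.
    apply: (coef2 _ (2^-1 * eigval p.1)) => // [|w]; first by lra.
    rewrite /e /oscillator_energy/= mulrDr -mulrA lerDr.
    by rewrite mulr_ge0 ?sqr_ge0 ?invr_ge0.
  have b2 : (fun w => inner (v2 w) (Y p.1 p.2)) \in Lfun P 2%:E.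
    apply: (coef2 _ (2^-1)) => // w.
    rewrite /e /oscillator_energy/= mulrDr lerDl.
    by rewrite mulr_ge0 ?invr_ge0// mulr_ge0 ?sqr_ge0//; lra.
  pose xi k w := inner (L (t k.+1) w - L (t k) w) (Y p.1 p.2).
  have xi2 k : xi k \in Lfun P 2%:E by
    exact: (levy_incr_Lfun2 _ _ _ _ hF hL hLQ _ Yp _ _ (t0 k) (tS k)).
  split => [k|].
    exact: (oscillator_energy_Lfun1 _ _ _ _ xi _ _ _ _ a2 b2 xi2).
  apply: (oscillator_energy_growth _ _ _ P (fun k => F (t k)) xi) => //.
  - by move=> k; exact: (filtration_sigma_algebra hF (t0 k)).
  - by move=> k; exact: (filtration_sub hF (t0 k)).
  - by move=> k; exact: (filtration_mono hF (t0 k) (tS k)).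
  - exact: coefG.
  - exact: coefG.
  - by move=> k; exact: (levy_incr_adapted _ _ _ hF hL _ Yp _ _ (t0 k) (tS k)).
  - by move=> k; exact: (levy_incr_mean _ _ _ _ hF hL hL0 hLQ _ Yp _ _ (t0 k) (tS k)).
  - by move=> k; exact: (levy_incr_indep _ _ _ hL _ Yp _ _ (t0 k) (tS k)).
  - by rewrite htau.
(* The mode of degree 0 is subtracted in E0, and nonnegative at step n. *)
have -> : E0 = (\sum_(p <- modes 1 kappa) 'E_P[e p 0%N])%E.
  rewrite -expectation_sum_seq; last by move=> p /mode[].
  congr expectation; apply/funext => w.
  by rewrite energyE (mode_energy00 _ hY) addrC addrA addNr add0r.
rewrite ge0_sume_distrr; last by move=> p _; exact: expectation_ge0.
apply: (@le_trans _ _ (\sum_(p <- modes 1 kappa) 'E_P[e p n])%E).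
  by rewrite big_seq [leRHS]big_seq; apply: lee_sum => p /mode[].
rewrite -expectation_sum_seq; last by move=> p /mode[].
rewrite unlock; apply: ge0_le_lower_integral => w; rewrite lee_fin.
  by apply: sumr_ge0.
by rewrite energyE lerDr.
Qed.
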